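(* Every $(P_7,C_7,C_4,\text{diamond})$-free graph $G$ satisfies $\chi(G)\leq \omega(G)+1$.
   Context: All graphs are finite and simple. $P_\ell$ and $C_\ell$ denote the chordless path and chordless cycle on $\ell$ vertices. The diamond is the complete graph on four vertices minus an edge. A graph is $(L_1,L_2,\ldots)$-free if it has no induced subgraph isomorphic to any $L_i$. $\chi(G)$ is the chromatic number and $\omega(G)$ the size of a largest clique of $G$. *)

(* Defs.v *)
From mathcomp Require Import all_boot.

Set Implicit Arguments.
Unset Strict Implicit.
Unset Printing Implicit Defensive.

Record sgraph := SGraph {
  vertex :> finType;
  adj : rel vertex;
  adj_sym : symmetric adj;
  adj_irr : irreflexive adj }.

Arguments adj {s}.

Definition graph_iso (G H : sgraph) : Prop :=
  exists2 f : G -> H, bijective f & forall x y, adj (f x) (f y) = adj x y.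

Section Induced.
Variables (G : sgraph) (S : {set G}).

Definition induced_adj : rel {x : G | x \in S} :=
  fun x y => adj (val x) (val y).

Lemma induced_adj_sym : symmetric induced_adj.
Proof. by move=> x y; apply: adj_sym. Qed.

Lemma induced_adj_irr : irreflexive induced_adj.
Proof. by move=> x; apply: adj_irr. Qed.

Definition induced : sgraph := SGraph induced_adj_sym induced_adj_irr.
End Induced.

Definition free (L G : sgraph) : Prop :=
  ~ exists S : {set G}, graph_iso (induced S) L.

Section Families.
Variable n : nat.

Definition path_adj : rel 'I_n :=
  fun i j => (i.+1 == j :> nat) || (j.+1 == i :> nat).

Lemma path_adj_sym : symmetric path_adj.
Proof. by move=> i j; rewrite /path_adj orbC. Qed.

Lemma path_adj_irr : irreflexive path_adj.
Proof. by move=> i; rewrite /path_adj orbb gtn_eqF. Qed.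

Definition path_graph : sgraph := SGraph path_adj_sym path_adj_irr.

(* The conjunct i != j only matters for n = 1; this is the n-cycle for n >= 3. *)
Definition cycle_adj : rel 'I_n :=
  fun i j => (i != j) && ((j == ordS i) || (i == ordS j)).

Lemma cycle_adj_sym : symmetric cycle_adj.
Proof. by move=> i j; rewrite /cycle_adj eq_sym orbC. Qed.

Lemma cycle_adj_irr : irreflexive cycle_adj.
Proof. by move=> i; rewrite /cycle_adj eqxx. Qed.

Definition cycle_graph : sgraph := SGraph cycle_adj_sym cycle_adj_irr.
End Families.

(* The only missing edge is the one between vertices 0 and 1, i.e. between
   the two distinct vertices smaller than 2. *)
Definition diamond_adj : rel 'I_4 :=
  fun i j => (i != j) && ~~ ((i < 2) && (j < 2)).

Lemma diamond_adj_sym : symmetric diamond_adj.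
Proof. by move=> i j; rewrite /diamond_adj eq_sym andbC [(i < 2) && _]andbC andbC. Qed.

Lemma diamond_adj_irr : irreflexive diamond_adj.
Proof. by move=> i; rewrite /diamond_adj eqxx. Qed.

Definition diamond : sgraph := SGraph diamond_adj_sym diamond_adj_irr.

Section Invariants.
Variable G : sgraph.

Definition clique (A : {set G}) : bool :=
  [forall x in A, forall y in A, (x != y) ==> adj x y].

Definition omega : nat := \max_(A : {set G} | clique A) #|A|.

Definition colorable (k : nat) : bool :=
  [exists c : {ffun G -> 'I_k}, forall x, forall y, adj x y ==> (c x != c y)].

Lemma colorable_ex : exists k, colorable k.
Proof.
exists #|G|; apply/existsP; exists [ffun x => enum_rank x].
apply/forallP=> x; apply/forallP=> y; apply/implyP=> xy.
rewrite !ffunE (inj_eq enum_rank_inj).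
by apply: contraTneq xy => ->; rewrite adj_irr.
Qed.

Definition chi : nat := ex_minn colorable_ex.
End Invariants.

(* Main.v *)
(* In a graph without induced C4 or diamond, two distinct nonadjacent vertices
   have at most one common neighbour.  Let S be a minimal vertex set whose
   induced subgraph is not (omega+1)-colourable.  Every vertex of S has at
   least omega+1 neighbours in S; hence, for every clique c of neighbours of v,
   at least two neighbours of v lie outside any clique containing v and c.  So
   whenever an induced subgraph of G[S] contains v and all but at most one of
   its known neighbours form a clique c, it can be grown by a new neighbour of v
   that is anticomplete to c.  Starting from one vertex and growing in this way
   while avoiding induced P7 and C7, an exhaustive search of a few hundred cases
   (run by computation) never passes 13 vertices, and the only subgraph that
   need not grow is the Petersen graph.  It is 3-colourable and attaching any
   further vertex to it leads to a contradiction, so it is a union of components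
   of G[S], and removing it contradicts the minimality of S. *)

Require Import Defs.
From mathcomp Require Import all_boot.

Set Implicit Arguments.
Unset Strict Implicit.
Unset Printing Implicit Defensive.

(** * Triangular adjacency codes and pattern search *)

Section Code.
Variables (T : eqType) (e : rel T).

(* Induced subgraphs are searched as triangular 0/1 matrices: the newest vertex
   comes first and its row lists its adjacencies to the older ones. *)
Fixpoint code (s : seq T) : seq (seq bool) :=
  if s is x :: s' then map (e x) s' :: code s' else [::].

Fixpoint row_match (x : T) (t : seq T) (r : seq bool) : bool :=
  match t, r with
  | y :: t', b :: r' =>
      if x == y then false
      else if eqb b (e x y) then row_match x t' r' else false
  | [::], [::] => true
  | _, _ => false
  end.

(* The conditionals stand for conjunctions: [vm_compute] would evaluate both
   arguments of [&&]. *)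
Fixpoint embeds (dom : seq T) (p : seq (seq bool)) (t : seq T) : bool :=
  if p is r :: p' then
    has (fun x => if row_match x t r then embeds dom p' (x :: t) else false)
      dom
  else true.

Lemma row_matchP x t r : row_match x t r -> x \notin t /\ map (e x) t = r.
Proof.
elim: t r => [|y t IH] [|b r] //=.
case: eqVneq => //= xy; case: eqbP => // -> /IH [xt ->].
by rewrite inE negb_or xy.
Qed.

(** [p] holds its rows oldest first, the reverse of a code, because each embedded vertex is pushed
    onto [t]; hence [catrev]. *)
Lemma embedsP dom p t : uniq t -> {subset t <= dom} ->
  embeds dom p t ->
  exists2 l, uniq l /\ {subset l <= dom} & code l = catrev p (code t).
Proof.
elim: p t => [|r p IH] t ut td /=; first by exists t.
case/hasP => x xd; case rm: (row_match x t r) => // ex.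
have [xt er] := row_matchP rm.
have [] := IH _ _ _ ex; first by rewrite /= xt.
  by move=> y; rewrite inE => /predU1P[->|/td].
by move=> l' h1 h2; exists l' => //; rewrite h2 /= er.
Qed.

End Code.

Fixpoint entry (a : seq (seq bool)) (i j : nat) : bool :=
  match a, i, j with
  | r :: _, 0, j'.+1 => nth false r j'
  | r :: _, i'.+1, 0 => nth false r i'
  | _ :: a', i'.+1, j'.+1 => entry a' i' j'
  | _, _, _ => false
  end.

Lemma size_code (T : eqType) (e : rel T) s : size (code e s) = size s.
Proof. by elim: s => //= x s ->. Qed.

Lemma entry_code (T : eqType) (e : rel T) x0 s i j :
  symmetric e -> irreflexive e -> i < size s -> j < size s ->
  entry (code e s) i j = e (nth x0 s i) (nth x0 s j).
Proof.
move=> e_sym e_irr; elim: s i j => // x s IH [|i] [|j] //=; rewrite ?ltnS => hi hj.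
- by rewrite (nth_map x0).
- by rewrite (nth_map x0) // e_sym.
- exact: IH.
Qed.

Lemma code_map (T U : eqType) (e : rel T) (f : rel U) (g : T -> U) s :
  {in s &, forall x y, f (g x) (g y) = e x y} -> code f (map g s) = code e s.
Proof.
elim: s => //= x s IH fe; rewrite -map_comp IH; last first.
  by move=> y z ys zs; apply: fe; rewrite inE ?ys ?zs orbT.
congr (_ :: _); apply/eq_in_map => y ys /=.
by apply: fe; rewrite inE ?eqxx ?ys ?orbT.
Qed.

(** Turns a computed match into an induced copy: [l] is the order in which [t] runs through the
    pattern, and [q] its adjacency on plain numbers. *)
Lemma not_free (G : sgraph) n (r : rel 'I_n.+1) rs ri (q : rel nat)
    (l : seq nat) (t : seq G) :
  (forall i j : 'I_n.+1, r i j = q i j) -> perm_eq l (iota 0 n.+1) ->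
  uniq t -> code adj t = code q l -> free (@SGraph _ r rs ri) G -> False.
Proof.
move=> rq lp ut ct; apply.
have sz : size t = size l by rewrite -(size_code adj t) ct size_code.
have ln (i : 'I_n.+1) : (i : nat) \in l by rewrite (perm_mem lp) mem_iota ltn_ord.
have [x0 _] : exists x0 : G, True.
  case: (t) sz => [|x t' _]; last by exists x.
  by move/esym/size0nil => l0; have := ln ord0; rewrite l0.
pose g (i : 'I_n.+1) := nth x0 t (index (i : nat) l).
have ginj : injective g.
  move=> i j /eqP; rewrite nth_uniq ?sz ?index_mem // => /eqP ij.
  by apply: val_inj; rewrite /= -(nth_index 0 (ln i)) ij nth_index.
have gadj i j : adj (g i) (g j) = r i j.
  rewrite /g -(entry_code x0 (@adj_sym G) (@adj_irr G)) ?sz ?index_mem // ct.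
  have qe : {in l &, forall i j, q i j = relpre inord r i j}.
    move=> x y; rewrite !(perm_mem lp) !mem_iota /= => xn yn.
    by rewrite rq !inordK.
  have -> : code q l = code r (map inord l).
    by symmetry; apply: code_map => x y xl yl; rewrite qe.
  rewrite (entry_code (inord 0)) ?size_map ?index_mem //.
  by rewrite !(nth_map 0) ?index_mem // !nth_index // !inord_val.
pose S := [set x | x \in codom g].
have inS (u : induced S) : val u \in codom g by have := valP u; rewrite inE.
have gS i : g i \in S by rewrite inE codom_f.
exists S; exists (fun u : induced S => iinv (inS u)); last first.
  by move=> x y; rewrite /= -gadj !f_iinv.
exists (fun i => exist _ (g i) (gS i) : induced S) => [u|i].
  by apply: val_inj; rewrite /= f_iinv.
by apply: ginj; rewrite f_iinv.
Qed.

(** * Forbidden patterns and the exhaustive search *)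

Definition nat_path (i j : nat) : bool := (i.+1 == j) || (j.+1 == i).

Definition nat_cycle (n i j : nat) : bool :=
  (i != j) && ((j == i.+1 %% n) || (i == j.+1 %% n)).

Definition nat_diamond (i j : nat) : bool := (i != j) && ~~ ((i < 2) && (j < 2)).

(* The vertices are embedded from right to left, starting with the newest vertex
   of the search; up to reversal of the path this is one of the vertices 0 to 3
   of P7. *)
Definition path7_orders : seq (seq nat) :=
  [:: [:: 6; 5; 4; 3; 2; 1; 0]; [:: 6; 5; 4; 3; 2; 0; 1];
      [:: 6; 5; 4; 3; 0; 1; 2]; [:: 6; 5; 4; 0; 1; 2; 3]].
Definition cycle7_order : seq nat := [:: 6; 5; 4; 3; 2; 1; 0].

(** Older vertices were tested before, so only patterns through vertex 0, the newest, are sought. It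
    plays the first pattern vertex, whose empty row [behead] drops. By symmetry one order suffices
    for C7. *)
Definition has_P7_or_C7 (a : seq (seq bool)) : bool :=
  has (fun p => embeds (entry a) (iota 0 (size a)) (behead (rev p)) [:: 0])
    (code (nat_cycle 7) cycle7_order :: map (code nat_path) path7_orders).

Fixpoint independent_subs (conf : rel nat) (l : seq nat) : seq (seq nat) :=
  if l is x :: l' then
    let r := independent_subs conf l' in
    r ++ [seq x :: t | t <- r & all (fun y => ~~ conf x y) t]
  else [:: [::]].

(* Candidate neighbourhoods of a new vertex adjacent to [v] and anticomplete to
   [c], such that nonadjacent vertices keep at most one common neighbour. *)
Definition neighbourhoods (a : seq (seq bool)) (v : nat) (c : seq nat) :
    seq (seq nat) :=
  let d := iota 0 (size a) in
  let e := entry a in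
  let conf i j := if e i j then false else has (fun k => e k i && e k j) d in
  let l := [seq i <- d | [&& i != v, i \notin c & ~~ conf v i]] in
  [seq t <- map (cons v) (independent_subs conf l) |
     all (fun w => if w \in t then true else count (e w) t <= 1) d].

Definition can_grow (a : seq (seq bool)) (v : nat) (c : seq nat) : bool :=
  let d := iota 0 (size a) in
  let e := entry a in
  [&& v < size a, all (fun i => i < size a) c, all (e v) c,
      all (fun i => all (fun j => (i == j) || e i j) c) c &
      size [seq i <- d | e v i & i \notin c] <= 1].

(** [can_grow] allows [c] to miss at most one neighbour of [v], so these candidates are exhaustive
    up to order. *)
Definition choices (a : seq (seq bool)) : seq (nat * seq nat) :=
  let d := iota 0 (size a) in
  flatten [seq let nb := [seq i <- d | entry a v i] in
               [seq (v, c) | c <- nb :: [seq [seq y <- nb | y != x] | x <- nb]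
                           & can_grow a v c]
          | v <- d].

Fixpoint colourings3 (a : seq (seq bool)) : seq (seq nat) :=
  if a is r :: a' then
    [seq k :: c | k <- [:: 0; 1; 2],
                  c <- [seq c <- colourings3 a' |
                         all (fun x => ~~ x.1 || (x.2 != k)) (zip r c)]]
  else [:: [::]].

Definition all_extensions (P : pred (seq (seq bool))) a v c : bool :=
  all (fun t =>
         let a' := [seq i \in t | i <- iota 0 (size a)] :: a in
         if has_P7_or_C7 a' then true else P a')
      (neighbourhoods a v c).

(* The second branch is reached only by the Petersen graph. *)
Fixpoint refute (fuel : nat) (a : seq (seq bool)) : bool :=
  if fuel is n.+1 then
    if choices a is (v, c) :: _ then all_extensions (refute n) a v c
    else if nilp (colourings3 a) then false
    else all (fun v => all_extensions (refute n) a v [::]) (iota 0 (size a))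
  else false.

(** A graph on m vertices is visited with fuel 14 - m, so 13 suffices as long as no graph on 14
    vertices survives. *)
Lemma refute_vertex : refute 13 [:: [::]].
Proof. by vm_compute. Qed.

(** * Consequences of the forbidden subgraphs *)

Section Forbidden.
Variable G : sgraph.
Hypotheses (hP7 : free (path_graph 7) G) (hC7 : free (cycle_graph 7) G)
  (hC4 : free (cycle_graph 4) G) (hD : free diamond G).

(** Two common neighbours would form a diamond with [x] and [y] if adjacent, and a C4 otherwise,
    with [x] and [y] opposite. *)
Lemma common_neighbour_uniq (x y z w : G) :
  x != y -> ~~ adj x y -> adj z x -> adj z y -> adj w x -> adj w y -> z = w.
Proof.
move=> xy nxy zx zy wx wy; apply/eqP/negPn/negP => zw.
have nE u v : adj u v -> u != v by apply: contraTneq => ->; rewrite adj_irr.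
have xyF := negbTE nxy.
case zwA: (adj z w).
  apply: (@not_free G 3 _ _ _ nat_diamond [:: 0; 1; 2; 3] [:: x; y; z; w]
            _ _ _ _ hD) => //=.
    by rewrite !inE !negb_or xy zw !(eq_sym x) !(eq_sym y) !nE.
  by rewrite !(adj_sym x z, adj_sym x w, adj_sym y z, adj_sym y w) zwA zx zy wx wy xyF.
apply: (@not_free G 3 _ _ _ (nat_cycle 4) [:: 0; 2; 1; 3] [:: x; y; z; w]
          _ _ _ _ hC4) => //=.
  by rewrite !inE !negb_or xy zw !(eq_sym x) !(eq_sym y) !nE.
by rewrite !(adj_sym x z, adj_sym x w, adj_sym y z, adj_sym y w) zwA zx zy wx wy xyF.
Qed.

Lemma has_P7_or_C7F (s : seq G) : uniq s -> has_P7_or_C7 (code adj s) = false.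
Proof.
case: s => [//|x0 s']; have: 0 < size (x0 :: s') by [].
move: (x0 :: s') => s s0.
move=> us; apply/negP; rewrite /has_P7_or_C7 size_code => /hasP[p pin ep].
have [||l [ul ls] cl] := embedsP _ _ ep => //.
  by move=> i; rewrite inE => /eqP->; rewrite mem_iota.
(* Putting back the empty row that [behead] dropped, [catrev] returns [p] itself. *)
have {}cl : code (entry (code adj s)) l = p.
  rewrite cl; move: pin; rewrite !inE.
  by do ![case/predU1P=> [->|]] => //; move/eqP->.
pose t := map (nth x0 s) l.
have ct : code adj t = p.
  rewrite -cl; apply: code_map => i j /ls + /ls; rewrite !mem_iota => iS jS.
  by rewrite (entry_code x0) //; [apply: adj_sym | apply: adj_irr].
have ut : uniq t.
  rewrite map_inj_in_uniq // => i j /ls + /ls; rewrite !mem_iota => iS jS /eqP.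
  by rewrite nth_uniq // => /eqP.
move: pin; rewrite inE => /predU1P[pE|/mapP[o oP pE]].
  by apply: (@not_free G 6 _ _ _ (nat_cycle 7) cycle7_order t _ _ ut _ hC7); rewrite ?ct.
apply: (@not_free G 6 _ _ _ nat_path o t _ _ ut _ hP7); rewrite ?ct //.
by move: oP; rewrite !inE; do ![case/predU1P=> [->|]] => //; move/eqP->.
Qed.
End Forbidden.

(** * Correctness of the enumerations; cliques *)

Lemma filter_independent (conf : rel nat) (p : pred nat) l :
  uniq l -> (forall x y, x \in l -> y \in l -> p x -> p y -> x != y -> ~~ conf x y) ->
  filter p l \in independent_subs conf l.
Proof.
elim: l => //= x l IH /andP[xl ul] H; rewrite mem_cat.
have {}IH : filter p l \in independent_subs conf l.
  by apply: IH => // y z yl zl; apply: H; rewrite inE ?yl ?zl orbT.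
case px: (p x); last by rewrite IH.
apply/orP; right; apply: map_f; rewrite mem_filter IH andbT.
apply/allP => y; rewrite mem_filter => /andP[py yl].
apply: H; rewrite ?inE ?eqxx ?yl ?orbT //.
by apply: contraNneq xl => ->.
Qed.

Lemma colourings3P (T : eqType) (e : rel T) (s : seq T) c :
  symmetric e -> uniq s -> c \in colourings3 (code e s) ->
  exists2 f : T -> nat, forall x, f x < 3 &
    {in s &, forall x y, e x y -> x != y -> f x != f y}.
Proof.
move=> e_sym us cc.
suff [f fc [f3 fP]] : exists2 f : T -> nat, c = map f s &
    (forall x, f x < 3) /\ {in s &, forall x y, e x y -> x != y -> f x != f y}.
  by exists f.
elim: s c us cc => [|x s IH] c.
  by move=> _ /=; rewrite inE => /eqP->; exists (fun=> 0).
case/andP=> xs us /allpairsPdep[k [c' [kin + ->]]].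
rewrite mem_filter => /andP[ok /(IH _ us)[f c'E [f3 fP]]].
exists (fun y => if y == x then k else f y).
  rewrite /= eqxx c'E; congr (_ :: _); apply/eq_in_map => y ys.
  by rewrite ifN //; apply: contraNneq xs => <-.
have kE y : y \in s -> e x y -> f y != k.
  move=> ys exy; move: ok; rewrite c'E; elim: (s) ys => //= z s' IHs.
  rewrite inE => /predU1P[<-|ys] /andP[]; first by rewrite exy.
  by move=> _; apply: IHs.
split=> [y|y z]; first by case: eqP => // _; move: kin; rewrite !inE; case/or3P=> /eqP->.
rewrite !inE; case: (eqVneq y x) => [->|yx] /=; case: (eqVneq z x) => [->|zx] //=.
- by move=> _ zs exz _; rewrite eq_sym kE.
- by move=> ys _; rewrite e_sym => /kE ->.
- by move=> ys zs; apply: fP.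
Qed.

Lemma choices_can_grow a v c : (v, c) \in choices a -> can_grow a v c.
Proof.
case/flattenP=> l /mapP[w _ ->] /mapP[c']; rewrite mem_filter.
by case/andP=> H _ [-> ->].
Qed.

Lemma cliqueP (G : sgraph) (A : {set G}) :
  reflect {in A &, forall x y, x != y -> adj x y} (clique A).
Proof.
apply: (iffP forall_inP) => [H x y xA yA xy | H x xA].
  by have /forall_inP/(_ y yA)/implyP := H x xA; apply.
by apply/forall_inP => y yA; apply/implyP; apply: H.
Qed.

Lemma clique_card (G : sgraph) (A : {set G}) : clique A -> #|A| <= omega G.
Proof. by move=> cA; rewrite /omega (bigmax_sup A). Qed.

(** * Soundness of the search *)

Section Refutation.
Variables (G : sgraph) (S : {set G}).
Hypotheses (hP7 : free (path_graph 7) G) (hC7 : free (cycle_graph 7) G)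
  (hC4 : free (cycle_graph 4) G) (hD : free diamond G).
Hypothesis degS : forall v, v \in S -> omega G < #|[set u in S | adj v u]|.

(* Otherwise [c], [v] and the neighbours of [v] outside [s] form a clique,
   which leaves [v] with at most [omega G] neighbours in [S]. *)
Lemma new_neighbour (s : seq G) v (c : {set G}) :
  v \in S -> {in c, forall w, adj v w} -> clique c ->
  #|[set u in S | adj v u && ((u \in s) && (u \notin c))]| <= 1 ->
  exists u, [/\ u \in S, u \notin s, adj v u & {in c, forall w, ~~ adj u w}].
Proof.
move=> vS cv /cliqueP cc le1.
pose N := [set u in S | adj v u && (u \notin s)].
have [/existsP[u /andP[]]|] :=
    boolP [exists u, (u \in N) && [forall w in c, ~~ adj u w]].
  rewrite inE => /and3P[uS vu us] /forall_inP H; by exists u; split.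
rewrite negb_exists => /forallP none.
have nv u : adj v u -> u != v by apply: contraTneq => ->; rewrite adj_irr.
have Nc u : u \in N -> exists2 w, w \in c & adj u w.
  move=> uN; have := none u; rewrite uN /= negb_forall => /existsP[w].
  by rewrite negb_imply negbK => /andP[]; exists w.
(* If [u] saw [x] in [c] but missed [w], then [v] and [x] would be two common neighbours of [u] and
   [w]. *)
have Nall u w : u \in N -> w \in c -> u != w -> adj u w.
  move=> uN wc uw; have [x xc ux] := Nc u uN; have [<- //|xw] := eqVneq x w.
  have vu : adj v u by move: uN; rewrite inE => /and3P[].
  apply: contraT => nuw.
  have : v = x.
    apply: (common_neighbour_uniq hC4 hD uw nuw) => //; first exact: cv.
      by rewrite adj_sym.
    exact: cc.
  by move=> vx; have := nv x (cv x xc); rewrite vx eqxx.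
have Q : clique (v |: (c :|: N)).
  apply/cliqueP => x y.
  have vN z : z \in c :|: N -> adj v z.
    by rewrite !inE => /orP[/cv|/and3P[]].
  case/setU1P=> [->|xQ]; case/setU1P=> [->|yQ]; first by rewrite eqxx.
  - by move=> _; apply: vN.
  - by move=> _; rewrite adj_sym vN.
  move: xQ yQ => /setUP[xc|xN] /setUP[yc|yN] xy; first exact: cc.
  - by rewrite adj_sym Nall // eq_sym.
  - exact: Nall.
  (* Otherwise [v] and [w] are two common neighbours of [x] and [y]. *)
  apply: contraT => nxy.
  have [w wc xw] := Nc x xN; have vw := cv w wc.
  have [yw|yw] := eqVneq y w; first by rewrite yw xw in nxy.
  have : v = w.
    apply: (common_neighbour_uniq hC4 hD xy nxy).
    - by apply: vN; rewrite inE xN orbT.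
    - by apply: vN; rewrite inE yN orbT.
    - by rewrite adj_sym.
    - by rewrite adj_sym Nall.
  by move=> vw'; have := nv w vw; rewrite vw' eqxx.
have vnot : v \notin c :|: N.
  rewrite !inE adj_irr andbF orbF; apply/negP => /cv; by rewrite adj_irr.
(* The clique gives [#|c :|: N| < omega G], and at most one neighbour of [v] in [S] lies outside
   [c :|: N], contradicting [degS]. *)
have := clique_card Q; rewrite cardsU1 vnot add1n => leQ.
have := degS vS; rewrite ltnNge => /negP[]; apply: leq_trans leQ.
apply: leq_trans (leq_add le1 (leqnn #|c :|: N|)).
apply: leq_trans (leq_card_setU _ _); apply: subset_leq_card.
apply/subsetP => u; rewrite !inE => /andP[-> ->] /=.
by case: (u \in s); case: (u \in c).
Qed.

(** Both filters discard only rows violating [common_neighbour_uniq]: a conflicting pair would share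
    [u] and an older vertex, and a vertex nonadjacent to [u] would share two neighbours with it. *)
Lemma neighbourhoods_complete (s : seq G) x0 u v c :
  uniq s -> u \notin s -> v < size s -> adj u (nth x0 s v) ->
  {in c, forall i, i < size s -> ~~ adj u (nth x0 s i)} ->
  exists2 t, t \in neighbourhoods (code adj s) v c &
    [seq i \in t | i <- iota 0 (size s)] = map (adj u) s.
Proof.
move=> us un vs uv uc; rewrite /neighbourhoods size_code.
set d := iota 0 _; set e := entry _; set conf := (fun i j => if e i j then _ else _).
set l := [seq i <- d | _].
have eE i j : i < size s -> j < size s -> e i j = adj (nth x0 s i) (nth x0 s j).
  by move=> *; rewrite /e (entry_code x0) //; [apply: adj_sym | apply: adj_irr].
have inD i : (i \in d) = (i < size s) by rewrite mem_iota.
have un' i : i < size s -> nth x0 s i != u.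
  by move=> si; apply: contraNneq un => <-; apply: mem_nth.
have nconf i j : i < size s -> j < size s -> i != j ->
    adj u (nth x0 s i) -> adj u (nth x0 s j) -> ~~ conf i j.
  move=> si sj ij ui uj; rewrite /conf eE //; case: ifPn => // nij.
  apply/hasPn => k; rewrite inD => sk; rewrite !eE //.
  apply/andP => -[ki kj]; have /eqP[] := un' k sk.
  by apply: (common_neighbour_uniq hC4 hD _ nij); rewrite ?nth_uniq.
pose p i := adj u (nth x0 s i); pose t := v :: filter p l.
have memt i : i < size s -> (i \in t) = p i.
  move=> si; rewrite inE mem_filter mem_filter inD si andbT.
  have [->|iv] /= := eqVneq i v; first by rewrite /p uv.
  case pi: (p i) => //=; rewrite nconf ?(eq_sym v) // andbT.
  by apply: contraL pi => /uc; apply.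
exists t; last first.
  rewrite -[in RHS](mkseq_nth x0 s) /mkseq -map_comp; apply/eq_in_map => i.
  by rewrite -/d inD => /memt.
rewrite mem_filter map_f ?andbT; last first.
  apply: filter_independent; first by rewrite filter_uniq ?iota_uniq.
  move=> i j; rewrite !mem_filter !inD => /andP[_ si] /andP[_ sj] pi pj ij.
  exact: nconf.
have tS i : i \in t -> i < size s.
  by rewrite inE => /predU1P[-> //|]; rewrite !mem_filter inD => /and3P[].
have ut : uniq t.
  by rewrite /= !filter_uniq ?iota_uniq // !mem_filter eqxx /= andbF.
apply/allP => w; rewrite inD => sw; case: ifPn => // wt.
have nuw : ~~ adj (nth x0 s w) u by rewrite adj_sym -[adj _ _]memt.
rewrite -size_filter; case E: [seq i <- t | e w i] => [|i [|j r]] //.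
have := filter_uniq (e w) ut; rewrite E /= inE negb_or => /andP[/andP[ij _] _].
have: i \in [seq i <- t | e w i] by rewrite E inE eqxx.
have: j \in [seq i <- t | e w i] by rewrite E !inE eqxx orbT.
rewrite !mem_filter => /andP[ewj jt] /andP[ewi it].
have /eqP : nth x0 s i = nth x0 s j.
  have si := tS i it; have sj := tS j jt; rewrite !eE // in ewi ewj.
  apply: (common_neighbour_uniq hC4 hD (un' w sw) nuw);
    rewrite 1?(adj_sym _ (nth x0 s w)) //.
    by rewrite adj_sym -[adj _ _]memt.
  by rewrite adj_sym -[adj _ _]memt.
by rewrite nth_uniq ?tS // (negPf ij).
Qed.

Lemma can_grow_neighbour (s : seq G) x0 v c :
  uniq s -> {subset s <= S} -> can_grow (code adj s) v c ->
  exists u, [/\ u \in S, u \notin s, adj u (nth x0 s v) &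
    {in c, forall i, i < size s -> ~~ adj u (nth x0 s i)}].
Proof.
move=> us sS; rewrite /can_grow size_code => /and5P[vs /allP cs /allP cv /allP cc le1].
have eE i j : i < size s -> j < size s ->
    entry (code adj s) i j = adj (nth x0 s i) (nth x0 s j).
  by move=> *; rewrite (entry_code x0) //; [apply: adj_sym | apply: adj_irr].
have vS : nth x0 s v \in S by rewrite sS ?mem_nth.
have [|||u [uS un vu uc]] := @new_neighbour s _ [set x in map (nth x0 s) c] vS.
- by move=> w; rewrite inE => /mapP[i ic ->]; rewrite -eE //; [apply: cv | apply: cs].
- apply/cliqueP => x y; rewrite !inE => /mapP[i ic ->] /mapP[j jc ->] ij.
  have /allP/(_ j jc)/orP[/eqP ijE|] := cc i ic; first by rewrite ijE eqxx in ij.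
  by rewrite eE ?cs.
- set d := [seq i <- _ | _] in le1.
  apply: leq_trans le1; rewrite -(size_map (nth x0 s)).
  apply: leq_trans (card_size _); apply: subset_leq_card.
  apply/subsetP => x; rewrite !inE => /and4P[_ vx xs xc].
  have xi : index x s < size s by rewrite index_mem.
  apply/mapP; exists (index x s); last by rewrite nth_index.
  rewrite mem_filter mem_iota xi eE // nth_index // vx /= andbT.
  by apply: contra xc => ic; apply/mapP; exists (index x s); rewrite ?nth_index.
- exists u; split=> //; first by rewrite adj_sym.
  by move=> i ic _; apply: uc; rewrite inE map_f.
Qed.

(** A nonempty 3-colourable union of components of the subgraph induced by [S]. *)
Definition splits_off (T : {set G}) : Prop :=
  [/\ T != set0, T \subset S,
      {in T & S, forall x y, adj x y -> y \in T} &
      exists2 f : G -> nat, forall x, f x < 3 &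
        {in T &, forall x y, adj x y -> f x != f y}].

(** The search is followed along actual vertices of [S]; it cannot grow forever, so it stops at a
    set to which nothing attaches. *)
Lemma refute_splits_off k (s : seq G) :
  uniq s -> 0 < size s -> {subset s <= S} -> refute k (code adj s) ->
  exists T, splits_off T.
Proof.
elim: k s => // k IH s us s0 sS.
have [x0 _] : exists x0 : G, True by case: (s) s0 => // x; exists x.
(* The row of [u] is among the candidates and creates no P7 or C7, so the induction continues with
   [u :: s]. *)
have growP v c u : u \in S -> u \notin s -> v < size s -> adj u (nth x0 s v) ->
    {in c, forall i, i < size s -> ~~ adj u (nth x0 s i)} -> 
    all_extensions (refute k) (code adj s) v c -> exists T, splits_off T.
  move=> uS un vs uv uc /allP gr.
  have [t /gr] := neighbourhoods_complete us un vs uv uc.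
  rewrite size_code => + tE; rewrite tE /=.
  have us' : uniq (u :: s) by rewrite /= un.
  rewrite [has_P7_or_C7 _](has_P7_or_C7F hP7 hC7 us'); apply: (IH (u :: s)) => //.
  by move=> x; rewrite inE => /predU1P[->|/sS].
rewrite /=; case E: choices => [|[v c] l]; last first.
  have vc : can_grow (code adj s) v c by apply: choices_can_grow; rewrite E mem_head.
  have [u [uS un uv uc]] := can_grow_neighbour x0 us sS vc.
  by apply: growP uS un _ uv uc; case/and5P: vc; rewrite size_code.
case C: colourings3 => [//|f0 fs] /= /allP gr.
have f0C : f0 \in colourings3 (code adj s) by rewrite C mem_head.
have [f f3 fP] := colourings3P (@adj_sym G) us f0C.
(* Without a forced choice, either some outside vertex of [S] attaches to [s], or [s] splits off. *)
have [/exists_inP[u /setDP[uS uns] /exists_inP[v vs uv]]|closed] :=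
  boolP [exists u in S :\: [set x in s], [exists v in [set x in s], adj u v]].
  rewrite !inE in uns vs.
  apply: (growP (index v s) [::] u uS uns); rewrite ?index_mem ?nth_index //.
  by apply: gr; rewrite size_code mem_iota index_mem.
exists [set x in s]; split.
- by apply/set0Pn; exists (nth x0 s 0); rewrite inE mem_nth.
- by apply/subsetP => x; rewrite inE => /sS.
- move=> x y xs yS xy; apply: contraNT closed => ys; apply/exists_inP; exists y.
    by rewrite inE ys.
  by apply/exists_inP; exists x; rewrite // adj_sym.
- exists f => // x y; rewrite !inE => xs ys xy; apply: fP => //.
  by apply: contraTneq xy => ->; rewrite adj_irr.
Qed.
End Refutation.

(** * Colouring by induction on the vertex set *)

Lemma set_colouring (G : sgraph)
  (hP7 : free (path_graph 7) G) (hC7 : free (cycle_graph 7) G)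
  (hC4 : free (cycle_graph 4) G) (hD : free diamond G) (S : {set G}) :
  exists2 f : G -> nat, forall x, f x <= omega G &
    {in S &, forall x y, adj x y -> f x != f y}.
Proof.
have [m] := ubnP #|S|; elim: m S => // m IH S ltS.
have IHsub (T : {set G}) : T \proper S -> exists2 f : G -> nat, forall x, f x <= omega G &
    {in T &, forall x y, adj x y -> f x != f y}.
  by move=> TS; apply: IH; apply: leq_trans (proper_card TS) ltS.
(* A vertex with at most [omega G] neighbours in [S] is coloured last, with a spare colour. *)
have [/exists_inP[v vS small]|] :=
  boolP [exists v in S, #|[set u in S | adj v u]| <= omega G].
  have [f f_le fP] := IHsub _ (properD1 vS).
  pose used := [set (inord (f u) : 'I_(omega G).+1) | u in [set u in S | adj v u]].
  have /set0Pn[k] : ~: used != set0.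
    rewrite -card_gt0 -(ltn_add2l #|used|) addn0 cardsC card_ord ltnS.
    exact: leq_trans (leq_imset_card _ _) small.
  rewrite inE => knew.
  have fk u : u \in S -> adj v u -> f u != k.
    move=> uS vu; apply: contraNneq knew => fuk.
    apply/imsetP; exists u; first by rewrite inE uS.
    by rewrite fuk inord_val.
  exists (fun x => if x == v then k : nat else f x).
    by move=> x; case: eqP => // _; rewrite -ltnS.
  move=> x y xS yS; case: (eqVneq x v) => [->|xv]; case: (eqVneq y v) => [->|yv].
  - by rewrite adj_irr.
  - by move=> vy; rewrite eq_sym fk.
  - by rewrite adj_sym; apply: fk.
  - by apply: fP; rewrite !inE ?xv ?yv.
rewrite negb_exists_in => /forall_inP big.
have degS v : v \in S -> omega G < #|[set u in S | adj v u]|.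
  by move=> /big; rewrite -ltnNge.
have [->|[x xS]] := set_0Vmem S; first by exists (fun=> 0) => // x y; rewrite inE.
(* Ensures that the three colours used on [T] are available. *)
have omega2 : 2 <= omega G.
  have /card_gt0P[y] := leq_ltn_trans (leq0n _) (degS x xS).
  rewrite inE => /andP[_ xy].
  have <- : #|[set x; y]| = 2.
    by rewrite cards2; case: eqP xy => // ->; rewrite adj_irr.
  apply: clique_card; apply/cliqueP => a b; rewrite !inE.
  by case/orP=> /eqP-> /orP[] /eqP->; rewrite ?eqxx // adj_sym.
have xS' : {subset [:: x] <= S} by move=> y; rewrite inE => /eqP->.
have [T [T0 TS closed [g g3 gP]]] :=
  refute_splits_off hP7 hC7 hC4 hD degS (isT : uniq [:: x]) isT xS' refute_vertex.
have [f f_le fP] : exists2 f : G -> nat, forall x, f x <= omega G &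
    {in S :\: T &, forall x y, adj x y -> f x != f y}.
  apply: IHsub; rewrite properE subsetDl /=; apply: contraNN T0 => /subsetP ST.
  apply/eqP/setP => y; rewrite inE; apply/negbTE/negP => yT.
  by have := ST y (subsetP TS y yT); rewrite inE yT.
(* No edge of [S] leaves [T], so the two colourings are compatible. *)
exists (fun x => if x \in T then g x else f x).
  by move=> y; case: ifP => // _; apply: leq_trans omega2; rewrite -ltnS.
move=> a b aS bS ab; case: (boolP (a \in T)) => aT.
  by rewrite (closed a b) // gP // (closed a b).
have bT : b \notin T by apply: contra aT => bT; rewrite (closed b a) // adj_sym.
by rewrite (negPf bT) fP // inE ?aT ?bT.
Qed.

Theorem theorem5p4 (G : sgraph)
  (hP7 : free (path_graph 7) G) (hC7 : free (cycle_graph 7) G)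
  (hC4 : free (cycle_graph 4) G) (hD : free diamond G) :
  chi G <= omega G + 1.
Proof.
have [f f_le fP] := set_colouring hP7 hC7 hC4 hD [set: G].
rewrite /chi; case: ex_minnP => m _; apply.
rewrite addn1; apply/existsP; exists [ffun x => inord (f x)].
apply/forallP => x; apply/forallP => y; apply/implyP => xy; rewrite !ffunE.
apply: contra (fP x y _ _ xy); rewrite ?inE // => /eqP/(congr1 val) /=.
by rewrite !inordK ?ltnS // => ->.
Qed.
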